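(* Let $\boldsymbol\xi_1,\dots,\boldsymbol\xi_N\in\mathbb R^d$, $d_{ij}=\|\boldsymbol\xi_i-\boldsymbol\xi_j\|^2$, let $n_0$ be a nonnegative integer and $n_1,\dots,n_K$ positive integers with $\sum_{k=0}^K n_k=N$. The joint outlier detection and cardinality-constrained clustering problem $$\min\Big\{\sum_{k=1}^K\sum_{i\in I_k}\Big\|\boldsymbol\xi_i-\tfrac1{n_k}\Big(\sum_{j\in I_k}\boldsymbol\xi_j\Big)\Big\|^2:\ (I_0,I_1,\dots,I_K)\in\mathfrak P(n_0,n_1,\dots,n_K)\Big\}$$ is equivalent to the mixed-integer linear program $$\begin{aligned}\text{minimize}\quad&\tfrac12\sum_{k=1}^K\tfrac1{n_k}\sum_{i,j=1}^N d_{ij}\,\eta_{ij}^k\\ \text{subject to}\quad&\pi_i^k\in\{0,1\},\ \eta_{ij}^k\in\mathbb R_+ && i,j=1,\dots,N,\ k=0,\dots,K\\ &\textstyle\sum_{i=1}^N\pi_i^k=n_k && k=0,\dots,K\\ &\textstyle\sum_{k=0}^K\pi_i^k=1 && i=1,\dots,N\\ &\eta_{ij}^k\ge\pi_i^k+\pi_j^k-1 && i,j=1,\dots,N,\ k=0,\dots,K.\end{aligned}$$ That is, the two problems have the same optimal value, and a partition $(I_0,\dots,I_K)\in\mathfrak P(n_0,\dots,n_K)$ is optimal in the former if and only if the binary variables defined by $\pi_i^k=1$ if $i\in I_k$ and $\pi_i^k=0$ otherwise are the $\pi$-part of some optimal solution of the mixed-integer linear program.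
   Context: $\|\cdot\|$ is the Euclidean norm. $\mathfrak P(n_0,\dots,n_K)$ is the set of ordered partitions $(I_0,\dots,I_K)$ of $\{1,\dots,N\}$ into pairwise disjoint sets with $|I_k|=n_k$ for all $k$ and $\bigcup_k I_k=\{1,\dots,N\}$. The set $I_0$ is the auxiliary outlier cluster, which does not contribute to the objective. *)

(* Defs.v *)
From mathcomp Require Import all_boot all_order all_algebra.
From mathcomp Require Import classical_sets reals.

Set Implicit Arguments.
Unset Strict Implicit.
Unset Printing Implicit Defensive.

Import Order.TTheory GRing.Theory Num.Theory.
Local Open Scope ring_scope.

Section Minimization.
Variables (R : realType) (T : Type).
Implicit Types (F : set T) (f : T -> R).

Definition is_optimal F f (x : T) : Prop :=
  F x /\ forall y, F y -> f x <= f y.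

(* Stronger than an infimum: the value must be attained. *)
Definition is_optimal_value F f (v : R) : Prop :=
  exists2 x, is_optimal F f x & f x = v.

End Minimization.

(* Euclidean norm; the norm that mathcomp-analysis puts on 'rV[R]_d is the   *)
(* sup norm.                                                                 *)
Definition enorm (R : realType) (d : nat) (x : 'rV[R]_d) : R :=
  Num.sqrt (\sum_(c < d) x ord0 c ^+ 2).

(* Points are indexed by 'I_N instead of {1, ..., N}; clusters by 'I_K.+1,   *)
(* index 0 being the outlier cluster.                                        *)
Definition ordered_partition (N K : nat) (n : 'I_K.+1 -> nat)
    (I : {ffun 'I_K.+1 -> {set 'I_N}}) : Prop :=
  [/\ forall k l, k != l -> [disjoint I k & I l],
      forall k, #|I k| = n k &
      (\bigcup_(k < K.+1) I k)%SET = [set: 'I_N]%SET].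

Definition clustering_cost (R : realType) (d N K : nat)
    (xi : 'I_N -> 'rV[R]_d) (n : 'I_K.+1 -> nat)
    (I : {ffun 'I_K.+1 -> {set 'I_N}}) : R :=
  \sum_(k < K.+1 | (0 < k)%N) \sum_(i in I k)
    enorm (xi i - (n k)%:R^-1 *: \sum_(j in I k) xi j) ^+ 2.

Section MILP.
Variables (R : realType) (N K : nat).

Definition milp_vars : Type :=
  (('I_N -> 'I_K.+1 -> R) * ('I_N -> 'I_N -> 'I_K.+1 -> R))%type.

Definition milp_feasible (n : 'I_K.+1 -> nat) (x : milp_vars) : Prop :=
  let: (p, eta) := x in
  [/\ (forall i k, p i k = 0 \/ p i k = 1) /\ (forall i j k, 0 <= eta i j k),
      forall k, \sum_(i < N) p i k = (n k)%:R,
      forall i, \sum_(k < K.+1) p i k = 1 &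
      forall i j k, p i k + p j k - 1 <= eta i j k].

Definition milp_cost (d : nat) (xi : 'I_N -> 'rV[R]_d) (n : 'I_K.+1 -> nat)
    (x : milp_vars) : R :=
  let: (_, eta) := x in
  2^-1 * \sum_(k < K.+1 | (0 < k)%N) (n k)%:R^-1 *
    \sum_(i < N) \sum_(j < N) enorm (xi i - xi j) ^+ 2 * eta i j k.

Definition partition_indicator (I : {ffun 'I_K.+1 -> {set 'I_N}})
    (i : 'I_N) (k : 'I_K.+1) : R :=
  if i \in I k then 1 else 0.

End MILP.

(* Main.v *)
Require Import Defs.
From mathcomp Require Import all_boot all_order all_algebra.
From mathcomp Require Import ring lra.
From mathcomp Require Import boolp classical_sets reals.

(** The within-cluster scatter around the mean equals the sum of the pairwise
    squared distances divided by twice the cluster size.  Since the [d_ij] are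
    nonnegative, it is optimal to take [eta] as small as possible, and for
    binary [pi] the smallest feasible value is
    [max 0 (pi_i + pi_j - 1) = pi_i * pi_j].  Binary assignments satisfying the
    constraints being the indicators of the ordered partitions, each partition
    has the same cost as the cheapest feasible point above it. *)

Set Implicit Arguments.
Unset Strict Implicit.
Unset Printing Implicit Defensive.

Import Order.TTheory GRing.Theory Num.Theory.
Local Open Scope ring_scope.

Lemma sqr_enorm (R : realType) (d : nat) (x : 'rV[R]_d) :
  enorm x ^+ 2 = \sum_(c < d) x ord0 c ^+ 2.
Proof. by rewrite sqr_sqrtr// sumr_ge0// => c _; exact: sqr_ge0. Qed.

(** With [m] the cardinality, [S] the sum and [Q] the sum of squares, both sides equal
    [Q - S ^+ 2 / m]. *)
Lemma scatter_mean_scalar (F : numFieldType) (T : finType) (A : {set T})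
    (x : T -> F) : (0 < #|A|)%N ->
  \sum_(i in A) (x i - #|A|%:R^-1 * \sum_(j in A) x j) ^+ 2 =
  2^-1 * (#|A|%:R^-1 * \sum_(i in A) \sum_(j in A) (x i - x j) ^+ 2).
Proof.
move=> A_gt0; have m0 : #|A|%:R != 0 :> F by rewrite pnatr_eq0 -lt0n.
set m : F := #|A|%:R in m0 *; set S := \sum_(j in A) x j.
pose Q := \sum_(j in A) x j ^+ 2.
(* Serves both sides: [c] is the mean on the left, and each [x i] in turn in the double sum. *)
have shift c : \sum_(i in A) (x i - c) ^+ 2 = Q - 2 * c * S + m * c ^+ 2.
  rewrite /Q /S mulr_sumr -sumrB /m -sumr_const mulr_suml -big_split /=.
  by apply: eq_bigr => i _; ring.
have -> : \sum_(i in A) \sum_(j in A) (x i - x j) ^+ 2 = 2 * (m * Q - S ^+ 2).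
  transitivity (\sum_(i in A) (Q - 2 * x i * S + m * x i ^+ 2)).
    apply: eq_bigr => i _; rewrite -shift; apply: eq_bigr => j _; ring.
  rewrite big_split/= sumrB -mulr_suml -!mulr_sumr -/S -/Q sumr_const.
  by rewrite -mulr_natl -/m; ring.
by rewrite shift; field.
Qed.

(** Squared norms split over coordinates, so exchanging the sums reduces this to the scalar identity
    in each coordinate. *)
Lemma scatter_mean (R : realType) (d : nat) (T : finType) (A : {set T})
    (x : T -> 'rV[R]_d) : (0 < #|A|)%N ->
  \sum_(i in A) enorm (x i - #|A|%:R^-1 *: \sum_(j in A) x j) ^+ 2 =
  2^-1 * (#|A|%:R^-1 * \sum_(i in A) \sum_(j in A) enorm (x i - x j) ^+ 2).
Proof.
move=> A_gt0.
under eq_bigr do rewrite sqr_enorm.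
under [in RHS]eq_bigr do under eq_bigr do rewrite sqr_enorm.
under [in RHS]eq_bigr do rewrite exchange_big.
rewrite exchange_big /= [in RHS]exchange_big /= !mulr_sumr.
apply: eq_bigr => c _.
transitivity (\sum_(i in A)
    (x i ord0 c - #|A|%:R^-1 * \sum_(j in A) x j ord0 c) ^+ 2).
  by apply: eq_bigr => i _; rewrite !mxE summxE.
rewrite scatter_mean_scalar//; congr (_ * (_ * _)).
by apply: eq_bigr => i _; apply: eq_bigr => j _; rewrite !mxE.
Qed.

(** The disjoint union [T] of the ['I_(n k)] has [N] elements; a bijection [f] from ['I_N] to [T]
    pulls its summands back to the blocks. *)
Lemma ordered_partition_exists (N K : nat) (n : 'I_K.+1 -> nat) :
  (\sum_(k < K.+1) n k)%N = N -> exists I, @ordered_partition N K n I.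
Proof.
move=> sum_n; pose T := {k : 'I_K.+1 & 'I_(n k)}.
have cardT : #|{: T}| = N.
  rewrite card_tagged sumnE big_map big_enum -[RHS]sum_n.
  by apply: eq_bigr => k _; rewrite card_ord.
pose f (i : 'I_N) : T := enum_val (cast_ord (esym cardT) i).
have f_inj : injective f by move=> i j /enum_val_inj/cast_ord_inj.
have f_onto t : exists i, f i = t.
  by exists (cast_ord cardT (enum_rank t)); rewrite /f cast_ordK enum_rankK.
exists [ffun k => [set i | tag (f i) == k]]; split.
- move=> k l; apply: contraNT => /pred0Pn[i] /=.
  by rewrite !ffunE !inE => /andP[/eqP <- /eqP <-].
(* Block [k] and ['I_(n k)] have the same image in [T], under the injections [f] and [Tagged]. *)
- move=> k; rewrite ffunE -(card_imset _ f_inj) -[RHS]card_ord.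
  have Tag_inj : injective (Tagged (fun k => 'I_(n k)) : 'I_(n k) -> T).
    by move=> a b /eqP; rewrite eq_Tagged => /eqP.
  rewrite -(card_imset _ Tag_inj); apply: eq_card => t.
  apply/imsetP/imsetP => [[i + ->]|[a _ ->]].
    rewrite inE; case: (f i) => l a /= /eqP <-; by exists a.
  by have [i fi] := f_onto (Tagged (fun k => 'I_(n k)) a); exists i; rewrite ?inE fi.
- apply/setP => i; rewrite inE; apply/bigcupP.
  by exists (tag (f i)); rewrite // ffunE inE.
Qed.

Section PartitionsAndPrograms.
Variables (R : realType) (d N K : nat) (xi : 'I_N -> 'rV[R]_d).
Variable n : 'I_K.+1 -> nat.
Implicit Types I : {ffun 'I_K.+1 -> {set 'I_N}}.

Definition indicator_prod I (i j : 'I_N) (k : 'I_K.+1) : R :=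
  partition_indicator R I i k * partition_indicator R I j k.

Lemma partition_indicator_ge0 I i k : 0 <= partition_indicator R I i k.
Proof. by rewrite /partition_indicator; case: ifP. Qed.

(** If both indicators are 1, the linear constraint gives [1 <= eta i j k]; otherwise the product is
    0 and nonnegativity of [eta] suffices. *)
Lemma indicator_prod_le I p eta i j k : p = partition_indicator R I ->
  milp_feasible n (p, eta) -> indicator_prod I i j k <= eta i j k.
Proof.
move=> -> [[_ /(_ i j k) eta0] _ _ /(_ i j k)].
by rewrite /indicator_prod /partition_indicator; do 2!case: ifP => _; lra.
Qed.

Lemma indicator_prod_feasible I : ordered_partition n I ->
  milp_feasible n (partition_indicator R I, indicator_prod I).
Proof.
move=> [disjI cardI coverI]; split; first split.
- by move=> i k; rewrite /partition_indicator; case: ifP; [right|left].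
- by move=> i j k; rewrite mulr_ge0 ?partition_indicator_ge0.
- by move=> k; rewrite -big_mkcond sumr_const cardI.
(* Covering provides a term equal to 1; disjointness makes all the others vanish. *)
- move=> i; have : i \in \bigcup_(k < K.+1) I k by rewrite coverI inE.
  case/bigcupP => k _ ik; rewrite (bigD1 k)//= big1 => [|l lk].
    by rewrite /partition_indicator ik addr0.
  by rewrite /partition_indicator (disjointFl (disjI _ _ lk) ik).
- move=> i j k; rewrite /indicator_prod /partition_indicator.
  by do 2!case: ifP => _; lra.
Qed.

Lemma milp_feasible_indicator p eta : @milp_feasible R N K n (p, eta) ->
  exists2 I, ordered_partition n I & p = partition_indicator R I.
Proof.
move=> [[p01 _] sum_p sum_p1 _].
pose I : {ffun 'I_K.+1 -> {set 'I_N}} := [ffun k => [set i | p i k == 1]].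
have pE i k : p i k = partition_indicator R I i k.
  rewrite /partition_indicator ffunE inE.
  by case: (p01 i k) => ->; rewrite ?eqxx// eq_sym oner_eq0.
exists I; last by apply/funext => i; apply/funext => k.
split.
- move=> k l kl; apply/pred0P => i /=; apply/negP.
  rewrite !ffunE !inE => /andP[/eqP pk /eqP pl].
  (* Two ones for the same [i] would push its sum to at least 2, as the remaining terms are
     nonnegative. *)
  have := sum_p1 i; rewrite (bigD1 k)//= (bigD1 l) 1?eq_sym//= pk pl.
  have : 0 <= \sum_(k0 < K.+1 | (k0 != k) && (k0 != l)) p i k0.
    by apply: sumr_ge0 => k0 _; rewrite pE partition_indicator_ge0.
  lra.
- move=> k; apply/eqP; rewrite -(eqr_nat R) -sum_p; apply/eqP.
  rewrite -sumr_const big_mkcond; apply: eq_bigr => i _; by rewrite pE.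
(* A point in no block would have only zero entries, against the sum 1. *)
- apply/setP => i; rewrite inE; apply/bigcupP; apply: contrapT => nI.
  have := sum_p1 i; rewrite big1 => [/esym/eqP|k _]; first by rewrite oner_eq0.
  rewrite pE /partition_indicator; case: ifP => // ik.
  by case: nI; exists k.
Qed.

Lemma ler_milp_cost p q (eta theta : 'I_N -> 'I_N -> 'I_K.+1 -> R) :
  (forall i j k, eta i j k <= theta i j k) ->
  milp_cost xi n (p, eta) <= milp_cost xi n (q, theta).
Proof.
move=> le_eta; rewrite /= ler_wpM2l ?invr_ge0//.
apply: ler_sum => k _; rewrite ler_wpM2l ?invr_ge0//.
apply: ler_sum => i _; apply: ler_sum => j _.
by rewrite ler_wpM2l ?sqr_ge0.
Qed.

Hypothesis n_gt0 : forall k : 'I_K.+1, (0 < k)%N -> (0 < n k)%N.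

(** The indicator products restrict the double sum to pairs inside [I k], where [scatter_mean]
    applies because the clusters in the objective are nonempty. *)
Lemma milp_cost_indicator_prod I p : ordered_partition n I ->
  milp_cost xi n (p, indicator_prod I) = clustering_cost xi n I.
Proof.
move=> [_ cardI _]; rewrite /milp_cost /clustering_cost mulr_sumr.
apply: eq_bigr => k k0; rewrite -cardI scatter_mean ?cardI ?n_gt0//.
congr (_ * (_ * _)); rewrite [RHS]big_mkcond; apply: eq_bigr => i _ /=.
rewrite /indicator_prod /partition_indicator; case: ifP => _; last first.
  by rewrite big1// => j _; rewrite mul0r mulr0.
rewrite [RHS]big_mkcond; apply: eq_bigr => j _ /=.
by case: ifP => _; rewrite mul1r ?mulr1 ?mulr0.
Qed.

Lemma clustering_cost_le_milp_cost I eta : ordered_partition n I ->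
  milp_feasible n (partition_indicator R I, eta) ->
  clustering_cost xi n I <= milp_cost xi n (partition_indicator R I, eta).
Proof.
move=> partI feas; rewrite -(milp_cost_indicator_prod (partition_indicator R I) partI).
by apply: ler_milp_cost => i j k; exact: indicator_prod_le feas.
Qed.

(** A competing feasible point lies above some partition [J], so its cost is at least that of [J],
    hence at least that of [I]. *)
Lemma optimal_indicator_prod I :
  is_optimal (@ordered_partition N K n) (clustering_cost xi n) I ->
  is_optimal (@milp_feasible R N K n) (milp_cost xi n)
    (partition_indicator R I, indicator_prod I).
Proof.
move=> [partI minI]; split; first exact: indicator_prod_feasible.
move=> [q eta] feas; rewrite milp_cost_indicator_prod//.
have [J partJ qE] := milp_feasible_indicator feas; rewrite qE in feas *.
exact: le_trans (minI _ partJ) (clustering_cost_le_milp_cost partJ feas).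
Qed.

(** The optimal [eta] may exceed the indicator product where its coefficient vanishes, so only the
    bound of the cost of [I] by that of [eta] is used; each [J] then competes through its own
    product. *)
Lemma optimal_indicator_partition I eta : ordered_partition n I ->
  is_optimal (@milp_feasible R N K n) (milp_cost xi n)
    (partition_indicator R I, eta) ->
  is_optimal (@ordered_partition N K n) (clustering_cost xi n) I.
Proof.
move=> partI [feas minI]; split=> // J partJ.
apply: le_trans (clustering_cost_le_milp_cost partI feas) _.
rewrite -(milp_cost_indicator_prod (partition_indicator R J) partJ).
exact/minI/indicator_prod_feasible.
Qed.

End PartitionsAndPrograms.

Lemma is_optimal_finite (R : realType) (T : finType) (F : set T) (f : T -> R) :
  (exists x, F x) -> exists x, is_optimal F f x.
Proof.
move=> [x0 Fx0]; have : `[< F x0 >] by apply/asboolP.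
(* The finite minimum ranges over a boolean predicate, so [F] is decided classically. *)
case/(@Order.TotalTheory.arg_minP _ _ _ x0 (fun x => `[< F x >]) f).
move=> x /asboolP Fx minx.
by exists x; split=> // y Fy; apply: minx; apply/asboolP.
Qed.

Theorem proposition7 (R : realType) (d N K : nat) (xi : 'I_N -> 'rV[R]_d)
    (n : 'I_K.+1 -> nat)
    (n_gt0 : forall k : 'I_K.+1, (0 < k)%N -> (0 < n k)%N)
    (sum_n : (\sum_(k < K.+1) n k)%N = N) :
  (exists v : R,
     is_optimal_value (@ordered_partition N K n) (clustering_cost xi n) v /\
     is_optimal_value (@milp_feasible R N K n) (milp_cost xi n) v) /\
  (forall I : {ffun 'I_K.+1 -> {set 'I_N}}, ordered_partition n I ->
     (is_optimal (@ordered_partition N K n) (clustering_cost xi n) I <->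
      exists eta : 'I_N -> 'I_N -> 'I_K.+1 -> R,
        is_optimal (@milp_feasible R N K n) (milp_cost xi n)
          (@partition_indicator R N K I, eta))).
Proof.
split=> [|I partI].
  (* Attainment comes from the finitely many partitions and is carried over to the program, whose
     [eta] ranges over a continuum. *)
  have [I optI] := is_optimal_finite (clustering_cost xi n)
    (ordered_partition_exists sum_n).
  exists (clustering_cost xi n I); split; first by exists I.
  exists (partition_indicator R I, indicator_prod R I).
    exact: optimal_indicator_prod.
  by apply: milp_cost_indicator_prod => //; case: optI.
split=> [optI|[eta]]; last exact: optimal_indicator_partition.
by exists (indicator_prod R I); exact: optimal_indicator_prod.
Qed.
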